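(* Let $(G,+,0,d)$ be a strictly convex metric group. If $K\subseteq G$ is a compact subgroup of $G$ (compact in the topology generated by $d$), then $K=\{0\}$.
   Context: A metric space $(X,d)$ is strictly convex if for any points $x,y\in X$ and any positive real numbers $a,b$ with $a+b=d(x,y)$, the intersection $B[x,a]\cap B[y,b]$ is a singleton, where $B[x,a]=\{z\in X: d(x,z)\le a\}$. A metric group is a (not necessarily commutative, additively written) group $(G,+,0)$ equipped with a metric $d:G\times G\to\mathbb{R}$ such that $d(x+c,y+c)=d(x,y)=d(c+x,c+y)$ for all $x,y,c\in G$. It is strictly convex if the metric space $(G,d)$ is strictly convex. *)

(* Defs.v *)
(* Built on MathComp and MathComp-Analysis. *)
From HB Require Import structures.
From mathcomp Require Import all_boot all_order all_algebra.
From mathcomp Require Import all_classical all_reals all_analysis.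

Set Implicit Arguments.
Unset Strict Implicit.
Unset Printing Implicit Defensive.

Import Order.TTheory GRing.Theory Num.Theory.

Local Open Scope classical_set_scope.
Local Open Scope ring_scope.

(* The library's [closed_ball] is the topological closure of the open ball,
   which in a general metric space can be smaller than this set. *)
Definition metric_cball (R : numDomainType) (X : metricType R) (x : X) (a : R) :
  set X := [set z | mdist x z <= a].

Definition strictly_convex (R : numDomainType) (X : metricType R) : Prop :=
  forall (x y : X) (a b : R), 0 < a -> 0 < b -> a + b = mdist x y ->
  exists z : X, metric_cball x a `&` metric_cball y b = [set z].

(* [groupType] is not assumed commutative and is written multiplicatively, so
   x * y, 1 and x^-1 stand for x + y, 0 and - x. *)
HB.mixin Record Metric_isMetricGroup (R : numDomainType) G
    & Group G & Metric R G := {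
  mdist_mulgr : forall c x y : G, mdist (x * c)%g (y * c)%g = mdist x y ;
  mdist_mulgl : forall c x y : G, mdist (c * x)%g (c * y)%g = mdist x y
}.

#[short(type="metricGroupType")]
HB.structure Definition MetricGroup (R : numDomainType) :=
  { G of Group G & Metric R G & Metric_isMetricGroup R G }.

(* Main.v *)
(* Write |x| = d(1, x).  Midpoints are unique.  If z is the midpoint of 1 and w,
   then by invariance so is z^-1 w, hence z^2 = w with |z| = |w| / 2; invariance
   under conjugation moreover shows that z commutes with the centralizer of w.
   If t^2 = 1 and z is the midpoint of 1 and t, then z^-1 is a midpoint too
   (z^4 = 1), so t = z^2 = 1: there is no 2-torsion.  Taking w = x^2, the elements
   z and x commute and (x z^-1)^2 = 1, so x = z and |x^2| = 2 |x|.  On a compact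
   subgroup, an element x of maximal |x| then satisfies 2 |x| <= |x|. *)
Require Import Defs.
From mathcomp Require Import all_boot all_order all_algebra.
From mathcomp Require Import all_classical all_reals all_analysis.
From mathcomp Require Import lra.

Import Order.TTheory GRing.Theory Num.Theory.
Import numFieldNormedType.Exports.

Local Open Scope classical_set_scope.
Local Open Scope ring_scope.

Section StrictlyConvexMetric.
Context {R : realFieldType} {X : metricType R}.
Hypothesis hX : strictly_convex X.

Lemma strictly_convex_midpoint (x y : X) :
  exists z, mdist x z = mdist x y / 2 /\ mdist z y = mdist x y / 2.
Proof.
(* Strict convexity only speaks of positive radii, so coinciding points are treated apart. *)
have [->|xy] := eqVneq x y; first by exists y; rewrite !mdistxx mul0r.
have d0 : 0 < mdist x y / 2 by rewrite divr_gt0// mdist_gt0.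
have [|z zE] := hX x y (mdist x y / 2) (mdist x y / 2) d0 d0; first by lra.
have [/= xz yz] : (metric_cball x (mdist x y / 2)
    `&` metric_cball y (mdist x y / 2)) z by rewrite zE.
(* Both distances are at most half of [mdist x y]; the triangle inequality forces equality. *)
have := metric_triangle x z y; rewrite /metric_cball/= in xz yz *.
rewrite (metric_sym z y) => tri.
by exists z; rewrite (metric_sym z y); split; lra.
Qed.

(** Every midpoint lies in both balls of radius [mdist x y / 2], which share a single point. *)
Lemma strictly_convex_midpoint_uniq (x y z w : X) :
  mdist x z = mdist x y / 2 -> mdist z y = mdist x y / 2 ->
  mdist x w = mdist x y / 2 -> mdist w y = mdist x y / 2 -> z = w.
Proof.
have [<-|xy] := eqVneq x y.
  by rewrite mdistxx mul0r => /mdist_positivity <- _ /mdist_positivity <-.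
have d0 : 0 < mdist x y / 2 by rewrite divr_gt0// mdist_gt0.
have [|u uE] := hX x y (mdist x y / 2) (mdist x y / 2) d0 d0; first by lra.
have inE v : mdist x v = mdist x y / 2 -> mdist v y = mdist x y / 2 -> v = u.
  move=> xv vy; suff : [set u] v by [].
  by rewrite -uE; split; rewrite /metric_cball/= ?xv// metric_sym vy.
by move=> xz zy xw wy; rewrite (inE z)// (inE w).
Qed.

End StrictlyConvexMetric.

Section MetricGroup.
Context {R : realFieldType} {G : metricGroupType R}.
Implicit Types x y z w t g : G.

Lemma mdist1V x : mdist 1%g x^-1%g = mdist 1%g x.
Proof. by rewrite -(mdist_mulgr x) mulVg mul1g metric_sym. Qed.

Lemma mdist_conjg g x y : mdist (x ^ g)%g (y ^ g)%g = mdist x y.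
Proof. by rewrite !conjgE mdist_mulgl mdist_mulgr. Qed.

Hypothesis hG : strictly_convex G.

Lemma strictly_convex_sqrt w : exists z : G,
  [/\ (z * z)%g = w, mdist 1%g z = mdist 1%g w / 2 &
      forall g, commute g w -> commute g z].
Proof.
have [z [z1 zw]] := strictly_convex_midpoint hG 1%g w.
exists z; split=> //.
  suff {2}-> : z = (z^-1 * w)%g by rewrite mulVKg.
  apply: (strictly_convex_midpoint_uniq hG 1%g w) => //.
    by rewrite -(mdist_mulgl z) mulg1 mulVKg.
  by rewrite -{2}(mul1g w) mdist_mulgr metric_sym mdist1V.
(* Conjugation by [g] is an isometry fixing 1 and [w], so [z ^ g] is again a midpoint. *)
move=> g /commute_sym/commgP/conjg_fixP wg; apply/commute_sym/commgP/conjg_fixP.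
apply: (strictly_convex_midpoint_uniq hG 1%g w) => //.
  by rewrite -{1}(conj1g g) mdist_conjg.
by rewrite -{1}wg mdist_conjg.
Qed.

Lemma strictly_convex_no_2torsion t : (t * t)%g = 1%g -> t = 1%g.
Proof.
move=> tt; have [z [zz z1 _]] := strictly_convex_sqrt t.
have zt : mdist z t = mdist 1%g t / 2 by rewrite -z1 -zz -{1}(mulg1 z) mdist_mulgl.
suff zV : z^-1%g = z by rewrite -zz -{1}zV mulVg.
apply: (strictly_convex_midpoint_uniq hG 1%g t) => //; first by rewrite mdist1V.
(* Cancelling [t] on the right then reduces the distance from [z^-1] to [t] to that from [z] to
   1. *)
have -> : (z^-1 = z * t)%g by apply: (mulgI z); rewrite mulgV mulgA zz tt.
by rewrite -{2}(mul1g t) mdist_mulgr metric_sym.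
Qed.

Lemma mdist1_sqr x : mdist 1%g (x * x)%g = mdist 1%g x * 2.
Proof.
have [z [zz z1 zC]] := strictly_convex_sqrt (x * x)%g.
have xz : commute x z by apply/zC/commuteM; exact: commute_refl.
suff -> : x = z by rewrite zz z1 divfK// pnatr_eq0.
(* As [x] and [z] commute, the square of [x / z] is [x^2 / z^2], which is 1. *)
apply/divg1_eq/strictly_convex_no_2torsion.
by rewrite -expg2 (expgnFl _ xz) !expg2 zz mulgV.
Qed.

End MetricGroup.

(** The triangle inequality makes [mdist x] 1-Lipschitz. *)
Lemma mdist_continuous {R : realFieldType} {X : metricType R} (x : X) :
  continuous (mdist x : X -> R).
Proof.
move=> y; apply/cvgrPdist_lt => e e0.
near=> z.
have : mdist y z < e.
  by near: z; apply/nbhs_ballP; exists e => //= z; rewrite ballEmdist.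
have := metric_triangle x y z; have := metric_triangle x z y.
rewrite (metric_sym z y) => ? ? ?; rewrite ltr_norml; apply/andP; split; lra.
Unshelve. all: by end_near. Qed.

Theorem corollary38 (R : realType) (G : metricGroupType R)
    (hG : strictly_convex G) (K : set G)
    (K_subgroup : group_closed (mem K)) (K_compact : compact K) :
  K = [set 1%g].
Proof.
have K1 : K 1%g by rewrite -in_setE; exact: K_subgroup.1.
have [||c cK cmax] := @compact_EVT_max G R (mdist 1%g) K _ K_compact.
- by exists 1%g.
- exact/continuous_subspaceT/mdist_continuous.
(* Since [c * c] stays in [K], maximality bounds twice the norm of [c] by the norm itself. *)
have c1 : mdist 1%g c <= 0.
  have := cmax _ (group_closedM K_subgroup cK cK).
  by rewrite (mdist1_sqr hG); lra.
apply/seteqP; split=> [x Kx|_ ->//].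
apply/esym/mdist_positivity/eqP; rewrite eq_le mdist_ge0 andbT.
by rewrite (le_trans _ c1)// cmax// in_setE.
Qed.
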